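(* Let $\kappa$ be an uncountable regular cardinal with $2^{<\kappa}=\kappa$. For every (code for a) $\kappa^+$-Borel set $B\subseteq{}^{\kappa}\kappa$, the following are equivalent: (1) Every ${<}\kappa$-closed forcing which adds a new element of ${}^{\kappa}2$ adds a new element to $B$. (2) There exists a ${<}\kappa$-closed forcing which adds a new element to $B$. (3) $B$ contains a $\kappa$-perfect subset. (4) There is a $\kappa^+$-Borel injection of ${}^{\kappa}2$ into $B$.
   Context: The spaces ${}^{\kappa}\kappa$ and ${}^{\kappa}2$ carry the bounded topology, generated by the sets $[s]$ of all extensions of $s$ of length $\kappa$, for $s\in{}^{<\kappa}\kappa$ (resp. $s\in{}^{<\kappa}2$). A set $P\subseteq{}^{\kappa}\kappa$ is $\kappa$-perfect if it is closed and homeomorphic to ${}^{\kappa}2$. The $\kappa^+$-Borel subsets of a space form the smallest family containing the open sets and closed under complements and unions of size at most $\kappa$; a function is $\kappa^+$-Borel if preimages of open sets are $\kappa^+$-Borel. Codes: a $\kappa^+$-Borel code is a pair $\langle S,f\rangle$ where $S\subseteq{}^{<\omega}A$ is a well-founded tree with $|A|\le\kappa$ and $f$ maps the leaves of $S$ to ${}^{<\kappa}\kappa$. The interpretation is $\mathcal{I}(s)=[f(s)]$ if $s$ is a leaf, and $\mathcal{I}(s)=\bigcap_t({}^{\kappa}\kappa\setminus\mathcal{I}(t))$, with $t$ ranging over the immediate successors of $s$ in $S$, otherwise; the coded set is $\mathcal{I}(\emptyset)$. Every $\kappa^+$-Borel subset $B$ of ${}^{\kappa}\kappa$ has a code, and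 for a generic extension $V[G]$, $B^{V[G]}$ denotes the set obtained by evaluating in $V[G]$ a ground-model code for $B$ (for ${<}\kappa$-closed forcing extensions the choice of the code is irrelevant). A forcing adds a new element to $B$ if $B^{V[G]}\setminus B\neq\emptyset$ in its generic extension $V[G]$. A forcing notion is ${<}\kappa$-closed if every decreasing sequence of length less than $\kappa$ has a lower bound. *)

(* Defs.v *)
From HB Require Import structures.
From mathcomp Require Import all_boot all_order.
From mathcomp Require Import boolp classical_sets functions cardinality topology.

Set Implicit Arguments.
Unset Strict Implicit.
Unset Printing Implicit Defensive.

Local Open Scope classical_set_scope.
Local Open Scope card_scope.
Local Open Scope order_scope.

(* An infinite cardinal is represented by an ordered type K whose elements are
   the ordinals below it; in particular lengths < kappa are elements of K. *)
Record regular_uncountable d (K : orderType d) : Prop := RegularUncountable {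
  ru_wf : well_founded (fun a b : K => a < b) ;
  ru_initial : forall a : K, ~ ([set: K] #<= [set b : K | b < a]) ;
  ru_regular : forall (a : K) (f : K -> K),
    exists b : K, forall c : K, c < a -> f c < b ;
  ru_uncountable : ~ countable [set: K]
}.

(* The set of functions s : a -> X with a < kappa. *)
Record ltk_seq d (K : orderType d) (X : Type) := LtkSeq {
  ltk_len : K ;
  ltk_val : {b : K | b < ltk_len} -> X
}.

Definition two_lt_kappa_eq_kappa d (K : orderType d) : Prop :=
  [set: ltk_seq K bool] #= [set: K].

(* An alias of K -> X, carrying the bounded topology. *)
Definition bspace d (K : orderType d) (X : Type) : Type := K -> X.

Definition bcone d (K : orderType d) (X : Type) (s : ltk_seq K X) :
    set (bspace K X) :=
  [set x | forall b : {b : K | b < ltk_len s}, x (sval b) = ltk_val b].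

Section BoundedTopology.
Context d (K : orderType d) (X : Type).

HB.instance Definition _ := gen_eqMixin (bspace K X).
HB.instance Definition _ := gen_choiceMixin (bspace K X).
HB.instance Definition _ := @isSubBaseTopological.Build (bspace K X)
  (set (bspace K X)) (range (@bcone d K X)) id.

End BoundedTopology.

Definition kperfect d (K : orderType d) (A : set (bspace K K)) : Prop :=
  closed A /\
  exists (f : bspace K bool -> bspace K K) (g : bspace K K -> bspace K bool),
    [/\ continuous f, {within A, continuous g}, range f = A & cancel f g].

Inductive kborel d (K : orderType d) (T : topologicalType) : set T -> Prop :=
| kborel_open U : open U -> kborel K U
| kborelC A : kborel K A -> kborel K (~` A)
| kborel_bigcup (F : set (set T)) : F #<= [set: K] ->
    (forall A, F A -> kborel K A) -> kborel K (\bigcup_(A in F) A).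

Definition kborel_fun d (K : orderType d) (T U : topologicalType)
    (f : T -> U) : Prop :=
  forall O : set U, open O -> kborel K (f @^-1` O).

(* Only the values of bc_val at the leaves of bc_tree matter. *)
Record bcode d (K : orderType d) := BCode {
  bc_alph : Type ;
  bc_card : [set: bc_alph] #<= [set: K] ;
  bc_tree : set (seq bc_alph) ;
  bc_root : bc_tree [::] ;
  bc_prefix : forall s a, bc_tree (rcons s a) -> bc_tree s ;
  bc_wf : well_founded
    (fun t s => bc_tree t /\ exists a, t = rcons s a) ;
  bc_val : seq bc_alph -> ltk_seq K K
}.

Definition bc_succ d (K : orderType d) (c : bcode K) (t s : seq (bc_alph c)) :=
  bc_tree t /\ exists a, t = rcons s a.

Definition bc_leaf d (K : orderType d) (c : bcode K) (s : seq (bc_alph c)) :=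
  bc_tree s /\ forall t, ~ bc_succ t s.

Fixpoint bc_interp d (K : orderType d) (c : bcode K) (s : seq (bc_alph c))
    (h : Acc (@bc_succ d K c) s) {struct h} : set (bspace K K) :=
  if pselect (bc_leaf s) then bcone (bc_val s)
  else [set x | forall t (ts : bc_succ t s), (~` bc_interp (Acc_inv h ts)) x].

Definition bc_set d (K : orderType d) (c : bcode K) : set (bspace K K) :=
  bc_interp (@bc_wf d K c [::]).

(* A forcing notion is a preorder P in which q <= p means that q is stronger
   than p.  The empty sequence has length < kappa, so a <kappa-closed P is
   nonempty. *)
Definition kclosed d (K : orderType d) d' (P : preorderType d') : Prop :=
  forall (a : K) (s : {b : K | b < a} -> P),
    (forall b c : {b : K | b < a}, sval b < sval c -> s c <= s b) ->
    exists p : P, forall b, p <= s b.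

Definition dense_below d' (P : preorderType d') (p : P) (D : set P) : Prop :=
  forall q, q <= p -> exists2 r, r <= q & D r.

(* (Nice) P-names for subsets of the ground model set K * X: in V[G], the name
   tau denotes { (a, x) | exists p in G, tau (p, (a, x)) }.  Every element of
   the space of functions from K to X of V[G] is denoted by such a name. *)
Definition pname d (K : orderType d) (X : Type) d' (P : preorderType d') :=
  set (P * (K * X)).

Section Forcing.
Context d (K : orderType d) (X : Type) d' (P : preorderType d').
Implicit Types (p q r : P) (tau : pname K X P).

(* p forces (a, x) \in tau *)
Definition forces_pair p tau (a : K) (x : X) : Prop :=
  dense_below p [set r | exists2 q, tau (q, (a, x)) & r <= q].

(* p forces that tau is a function from K to X *)
Definition forces_fun p tau : Prop :=
  (forall a, dense_below p [set r | exists x, forces_pair r tau a x]) /\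
  (forall a x y, x <> y ->
    forall q, q <= p -> ~ (forces_pair q tau a x /\ forces_pair q tau a y)).

(* p forces s \subset tau, i.e. that tau belongs to the cone of s in V[G] *)
Definition forces_cone p tau (s : ltk_seq K X) : Prop :=
  forall b : {b : K | b < ltk_len s}, forces_pair p tau (sval b) (ltk_val b).

(* p forces that the function tau is not an element of the ground model set A *)
Definition forces_notin p tau (A : set (bspace K X)) : Prop :=
  forall x, A x -> forall q, q <= p -> ~ (forall a, forces_pair q tau a (x a)).

End Forcing.

(* p forces that tau belongs to the interpretation of the node s in V[G] *)
Fixpoint forces_interp d (K : orderType d) d' (P : preorderType d')
    (c : bcode K) (p : P) (tau : pname K K P) (s : seq (bc_alph c))
    (h : Acc (@bc_succ d K c) s) {struct h} : Prop :=
  if pselect (bc_leaf s) then forces_cone p tau (bc_val s)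
  else forall t (ts : bc_succ t s),
    forall q, q <= p -> ~ forces_interp q tau (Acc_inv h ts).

Definition forces_in d (K : orderType d) d' (P : preorderType d')
    (p : P) (tau : pname K K P) (c : bcode K) : Prop :=
  forces_interp p tau (@bc_wf d K c [::]).

(* Every condition forces that there is a new function from K to 2. *)
Definition adds_new_binary d (K : orderType d) d' (P : preorderType d') : Prop :=
  forall p : P, dense_below p
    [set q | exists tau : pname K bool P,
      forces_fun q tau /\ forces_notin q tau [set: bspace K bool]].

(* Every condition forces that B^{V[G]} \ B is nonempty, for B coded by c. *)
Definition adds_new_to d (K : orderType d) d' (P : preorderType d')
    (c : bcode K) : Prop :=
  forall p : P, dense_below p
    [set q | exists tau : pname K K P,
      [/\ forces_fun q tau, forces_in q tau c & forces_notin q tau (bc_set c)]].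

(* Main.v *)
Require Import Defs.
From HB Require Import structures.
From mathcomp Require Import all_boot all_order.
From mathcomp Require Import boolp classical_sets functions cardinality topology.
From mathcomp Require Import finmap.

(** The equivalence rests on a topological reading of forcing.  For a
<kappa-closed P, a descending sequence g : K -> P can be made to meet any
kappa prescribed dense sets.  Say that p generically forces a property Phi of
such sequences ([gforces]) when Phi holds for every descending g that goes
below p and meets kappa suitably chosen sets dense below p: the set of
sequences satisfying Phi is comeager below p.  Generic forcing is closed under
kappa intersections ([gforces_forall]), it is local ([gforces_glue], by a
maximal antichain), and it is consistent because generic sequences exist in
the ground model ([gforces_consistent]).  A property has the Baire property
when densely many conditions generically force it or its negation ([decides]);
this class contains the open sets and is closed under complements and kappa
unions, so it contains all kappa^+-Borel sets.

Along a descending sequence a name tau for a function takes a value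
[name_val tau g] in the ground model.  The truth lemma [forces_interpP] says
that the forcing relation for codes agrees with generic forcing: p forces that
tau belongs to the set coded by c iff p generically forces that the value of
tau lies in that set.  After this, no code is ever evaluated again.

(1) implies (2): Cohen forcing is <kappa-closed and adds a new binary sequence.

(2) implies (3) ([perfect_subset]): a name for a new element of B cannot be
decided by any condition, so below each condition it splits into two
incompatible values.  A fusion along the full binary tree of height kappa
([fusion_tree]) gives a generic sequence for each branch x, hence a point f(x)
of B.  The branch can be read off from f(x), and the reading function g makes
sense and is continuous on the whole space; so the range of f is the closed
set of fixed points of f o g.

(3) implies (4): the homeomorphism is a continuous injection.

(4) implies (1) ([borel_injection_adds_new]): for a name tau of a new binary
sequence and a Borel injection f into B, the Baire property of the preimages of
open sets yields a name sigma for f(tau).  Generically sigma takes the value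
f(tau), which lies in B.  If a condition forced sigma to be a ground model
point y, all generic values of tau below it would be sent to y, so they would
coincide by injectivity, and tau would not be new. *)

Set Implicit Arguments.
Unset Strict Implicit.
Unset Printing Implicit Defensive.
Import Order.Theory.

Local Open Scope order_scope.
Local Open Scope card_scope.
Local Open Scope classical_set_scope.

(** * Ordinals below kappa *)

Lemma card_le_injP (T U : Type) (A : set T) (u0 : U) : A #<= [set: U] ->
  exists f : T -> U, forall x y, A x -> A y -> f x = f y -> x = y.
Proof.
pose pU : pointedType :=
  HB.pack U (gen_eqMixin U) (gen_choiceMixin U) (isPointed.Build U u0).
move=> /(@pcard_injP _ pU)[f fI]; exists f => x y Ax Ay.
exact: (fI _ _ (mem_set Ax) (mem_set Ay)).
Qed.

Section OrdinalsBelowKappa.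
Context d (K : orderType d) (hK : regular_uncountable K).
Implicit Types a b c : K.

Lemma ltk_ind (Q : K -> Prop) :
  (forall a, (forall b, b < a -> Q b) -> Q a) -> forall a, Q a.
Proof. exact: (well_founded_ind (ru_wf hK)). Qed.

Lemma least_elt (Q : set K) : Q !=set0 ->
  exists2 a, Q a & forall b, Q b -> a <= b.
Proof.
case=> a0; elim/ltk_ind: a0 => a IH Qa.
have [[b ba Qb]|nb] := pselect (exists2 b, b < a & Q b); first exact: IH Qb.
exists a => // b Qb; rewrite leNgt; apply/negP => ba.
by apply: nb; exists b.
Qed.

Lemma inhabitedK : exists a : K, True.
Proof.
apply: contrapT => nK; apply: (ru_uncountable hK).
suff -> : [set: K] = set0 by exact: countable0.
by rewrite -subset0 => a _; apply: nK; exists a.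
Qed.

Lemma exists_gt a : exists b, a < b.
Proof.
have [c ca] : exists c, c != a.
  apply: contrapT => nK; apply: (ru_uncountable hK).
  suff -> : [set: K] = [set a] by exact: countable1.
  rewrite predeqE => b; split=> // _ /=.
  by apply: contrapT => ba; apply: nK; exists b; apply/eqP.
have [ac|ca'] : a < c \/ c < a by apply/orP; rewrite -neq_lt eq_sym.
  by exists c.
have [b bP] := ru_regular hK a (fun=> a).
by exists b; exact: bP ca'.
Qed.

Lemma bounded_image a (f : K -> K) : exists b, forall c, c <= a -> f c < b.
Proof.
have [a' aa'] := exists_gt a; have [b bP] := ru_regular hK a' f.
by exists b => c ca; apply: bP; exact: le_lt_trans aa'.
Qed.

Lemma injective_succ :
  exists2 s : K -> K, injective s & forall a, a < s a.
Proof.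
have /choice[s sP] : forall a, exists b, a < b /\ forall c, a < c -> b <= c.
  move=> a; have [b ab bP] := @least_elt [set b | a < b] (exists_gt a).
  by exists b.
exists s => [a b sab|a]; last exact: (sP a).1.
case: (ltgtP a b) => // ab.
  by have := le_lt_trans ((sP a).2 _ ab) (sP b).1; rewrite sab ltxx.
by have := le_lt_trans ((sP b).2 _ ab) (sP a).1; rewrite sab ltxx.
Qed.

Definition indicator_seq a (A : set K) : ltk_seq K bool :=
  @LtkSeq _ K bool a (fun i => `[< A (sval i) >]).

Lemma indicator_seq_inj a b A B : indicator_seq a A = indicator_seq b B ->
  a = b /\ forall i, i < a -> (A i <-> B i).
Proof.
pose ones (s : ltk_seq K bool) i :=
  exists2 j : {b | b < ltk_len s}, sval j = i & ltk_val j.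
move=> eAB; have ab : a = b by exact: (congr1 (@ltk_len _ K bool) eAB).
subst b; split=> // i ia.
have onesE C : C i <-> ones (indicator_seq a C) i.
  split=> [Ci|[[j ja] /= <- /asboolP]//].
  by exists (exist _ i ia) => //=; apply/asboolP.
by rewrite (onesE A) (onesE B) eAB.
Qed.

(** Code (a, b) by the sequence of length max a b whose only mark is at
min a b.  The mark falls outside the sequence exactly when a = b, so the
sequence determines {a, b}, and one bit gives the order.  A bit u is absorbed
into an ordinal a through the constant sequence u of length s a, which is never
empty; injectivity of s recovers a. *)
Lemma injective_pairing (h2K : two_lt_kappa_eq_kappa K) :
  exists f : K * K -> K, injective f.
Proof.
have [k0 _] := inhabitedK.
have [h hI] : exists h : ltk_seq K bool -> K, injective h.
  have := h2K; rewrite /two_lt_kappa_eq_kappa card_eq_le => /andP[+ _].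
  by move=> /(card_le_injP k0)[h hI]; exists h => x y; exact: hI.
have [s sI sgt] := injective_succ.
pose flag (z : bool * K) := h (indicator_seq (s z.2) [set i | z.1]).
have flagI : injective flag.
  move=> [u a] [v b] /hI/indicator_seq_inj[/sI /= ab uv].
  move: (uv a (sgt a)) => /=; rewrite ab.
  by case: u v {uv} => [] [] // [] => [/(_ isT)//|_ /(_ isT)].
pose minmax (z : K * K) :=
  h (indicator_seq (Order.max z.1 z.2) [set i | i = Order.min z.1 z.2]).
exists (fun z => flag (z.1 <= z.2, minmax z)) => -[a b] [a' b'].
move=> /flagI[/= le_eq /hI/indicator_seq_inj[/= maxE minE]].
have minmaxE : Order.min a b = Order.min a' b'.
  have [m1|] := ltP (Order.min a b) (Order.max a b).
    by apply/(minE _ m1).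
  have [m2 _|] := ltP (Order.min a' b') (Order.max a' b').
    by apply/esym; apply/minE => //; rewrite maxE.
  rewrite -maxE => le1 le2.
  have e1 : Order.min a b = Order.max a b.
    by apply/eqP; rewrite eq_le le2 andbT ge_min !le_max lexx.
  by apply/eqP; rewrite eq_le; move: le1 le2; rewrite e1 => -> _;
     rewrite maxE ge_min !le_max lexx.
move: maxE minmaxE le_eq; rewrite /Order.max /Order.min.
by case: (ltgtP a b) => ab; case: (ltgtP a' b') => ab' // *; congr pair;
  congruence.
Qed.

End OrdinalsBelowKappa.

(** * The bounded topology *)

Definition eq_below d (K : orderType d) X a (x y : bspace K X) :=
  forall b, b < a -> x b = y b.

Section BoundedTopology.
Context d (K : orderType d) (hK : regular_uncountable K).

Definition initial_seq X a (x : bspace K X) : ltk_seq K X :=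
  @LtkSeq _ K X a (fun b => x (sval b)).

Lemma bcone_initial X a (x y : bspace K X) :
  bcone (initial_seq a x) y <-> eq_below a x y.
Proof.
split=> [H b ba|H [b ba]]; first by rewrite (H (exist _ b ba)).
by rewrite /= H.
Qed.

(** A finite intersection of cones around x only constrains coordinates below
the longest of their stems. *)
Lemma eq_below_cones X (x : bspace K X) (s : seq (set (bspace K X))) :
  (forall V, V \in s -> range (@bcone d K X) V /\ V x) ->
  exists a, forall y, eq_below a x y -> forall V, V \in s -> V y.
Proof.
elim: s => [_|V s IH sP]; first by have [a _] := inhabitedK hK; exists a.
have [W Ws|a aP] := IH; first by apply: sP; rewrite inE Ws orbT.
have [[s0 _ <-] s0x] := sP _ (mem_head V s).
exists (Order.max a (ltk_len s0)) => y xy W.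
rewrite inE => /predU1P[->|]; last first.
  by apply: aP => b ba; apply: xy; rewrite lt_max ba.
by move=> b; rewrite -s0x; apply/esym/xy; rewrite lt_max (svalP b) orbT.
Qed.

Lemma open_bspace X (U : set (bspace K X)) :
  open U <-> forall x, U x -> exists a, forall y, eq_below a x y -> U y.
Proof.
split=> [|H].
- move=> [F FI <-] x [V FV Vx]; have [D sD DV] := FI _ FV.
  rewrite -DV in Vx.
  have [|a aP] := @eq_below_cones X x (enum_fset D).
    by move=> W WD; split; [exact/set_mem/sD|exact: Vx].
  exists a => y xy; exists V => //; suff: V y by [].
  by rewrite -DV => W; exact: aP.
- pose F := [set V | exists2 s, V = @bcone _ K X s & V `<=` U].
  exists F; last first.
    rewrite eqEsubset; split=> [x [V [s -> sU] /sU]//|x Ux].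
    have [a aU] := H x Ux; exists (bcone (initial_seq a x)).
      by exists (initial_seq a x) => // y /bcone_initial /aU.
    by apply/bcone_initial => b.
  move=> V [s Vs _].
  exists [fset V]%fset.
    by move=> W; rewrite !inE => /eqP ->; apply/mem_set; exists s.
  rewrite predeqE => y; split=> [|Vy W /=]; first by apply; rewrite /= inE.
  by rewrite inE => /eqP ->.
Qed.

Lemma open_coord X a v : open [set x : bspace K X | x a = v].
Proof.
apply/open_bspace => x /= <-; have [b ab] := exists_gt hK a.
by exists b => y /(_ a ab).
Qed.

(** By regularity the moduli of the fewer than kappa coordinates below a have
a common bound, so continuity can be checked one coordinate at a time. *)
Lemma continuous_bspace X Y (f : bspace K X -> bspace K Y) :
  (forall x a, exists b, forall y, eq_below b x y -> f x a = f y a) ->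
  continuous f.
Proof.
move=> fc; apply/continuousP => U /open_bspace oU.
apply/open_bspace => x /oU[a aU].
have /choice[m mP] := fc x; have [b bP] := ru_regular hK a m.
exists b => y xy; apply: aU => c ca; apply: mP => e ec.
by apply: xy; exact: lt_trans ec (bP c ca).
Qed.

Lemma closed_fixpoints X (h : bspace K X -> bspace K X) :
  continuous h -> closed [set x | h x = x].
Proof.
move=> hc; rewrite -[X in closed X]setCK; apply: open_closedC.
apply/open_bspace => x /eqP; rewrite /= => /eqP hx.
have [a xa] : exists a, h x a <> x a.
  apply: contrapT => nx; apply/hx/funext => a.
  by apply: contrapT => xa; apply: nx; exists a.
have := (@continuousP _ _ h).1 hc _ (open_coord a (h x a)).
move=> /open_bspace/(_ x erefl)[b bP]; have [c ac] := exists_gt hK a.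
exists (Order.max b c) => y xy hy; apply: xa.
have <- : h y a = h x a by apply: bP => e eb; apply: xy; rewrite lt_max eb.
by rewrite hy; apply/esym/xy; rewrite lt_max ac orbT.
Qed.

End BoundedTopology.

(** * Generic sequences of conditions *)

Section GenericSequences.
Context d (K : orderType d) (hK : regular_uncountable K).
Context d' (P : preorderType d') (hP : kclosed K P).
Implicit Types (p q r : P) (g : K -> P) (D : K -> set P) (Phi : set (K -> P)).

(** A family of descending sequences indexed by the branches of the binary
tree: T x a is chosen in D a below all earlier choices, after the choice made
at stage b has been replaced by its successor of direction x b.  As T x a is
computed from x below a only, branches share their common part.  With
split e q = q this is also the construction of a single sequence meeting kappa
dense sets. *)
Lemma fusion_tree p D (split : bool -> P -> P) :
  (forall a, dense_below p (D a)) ->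
  (forall e q, q <= p -> split e q <= q) ->
  exists T : (K -> bool) -> K -> P,
    [/\ forall x a, T x a <= p,
        forall x a, D a (T x a),
        forall x a b, a < b -> T x b <= split (x a) (T x a) &
        forall x y a, eq_below a x y -> T x a = T y a].
Proof.
move=> Dd splitP.
have /choice[ext extP] : forall z : K * P, exists r,
    z.2 <= p -> r <= z.2 /\ D z.1 r.
  move=> [a q] /=; have [qp|nqp] := pselect (q <= p); last by exists q.
  by have [r rq Dr] := Dd a q qp; exists r.
(* The bound p is required separately because the empty sequence is bounded by
   conditions unrelated to p. *)
have /choice[lb lbP] : forall z : {a & {b : K | b < a} -> P}, exists r,
    (forall b c, sval b < sval c -> tagged z c <= tagged z b) ->
    (forall b, tagged z b <= p) -> r <= p /\ forall b, r <= tagged z b.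
  move=> [a s] /=.
  have [[sdec sp]|ns] := pselect ((forall b c, sval b < sval c -> s c <= s b)
      /\ forall b, s b <= p); last by exists p => *; exfalso; apply: ns.
  have [[b0 _]|nb] := pselect (exists b : {b | b < a}, True).
    have [r rP] := hP sdec; exists r => _ _; split=> //.
    exact: le_trans (rP b0) (sp b0).
  by exists p => _ _; split=> // b; exfalso; apply: nb; exists b.
pose F x a (T : forall b, b < a -> P) := ext (a, lb (existT _ a
  (fun b : {b | b < a} => split (x (sval b)) (T (sval b) (svalP b))))).
pose T x := Fix (ru_wf hK) (fun=> P) (F x).
have TE x a : T x a = F x a (fun b _ => T x b).
  apply: (Fix_eq (ru_wf hK) (fun=> P) (F x)) => b f g fg; congr F.
  apply: functional_extensionality_dep => c.
  by apply: functional_extensionality_dep => cb.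
have TP x a : [/\ T x a <= p, D a (T x a) &
    forall b, b < a -> T x a <= split (x b) (T x b)].
  elim/(ltk_ind hK): a => a IH.
  have [||lp lT] := lbP (existT _ a
    (fun b : {b | b < a} => split (x (sval b)) (T x (sval b)))).
  - move=> [b ba] [c ca] /= bc; have [cp _ cT] := IH c ca.
    exact: le_trans (splitP _ _ cp) (cT b bc).
  - move=> [b ba] /=; have [bp _ _] := IH b ba.
    exact: le_trans (splitP _ _ bp) bp.
  have [el De] := extP (a, _) lp.
  rewrite TE; split=> //; first exact: le_trans el lp.
  by move=> b ba; exact: le_trans el (lT (exist _ b ba)).
exists T; split=> [x a|x a|x a b ab|x y a].
- by have [] := TP x a.
- by have [] := TP x a.
- by have [_ _] := TP x b; exact.
elim/(ltk_ind hK): a => a IH xy; rewrite !TE /F; congr (ext (a, lb _)).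
congr existT; apply/funext => -[b ba] /=; rewrite (xy b ba) (IH b ba) //.
by move=> c cb; apply: xy; exact: lt_trans ba.
Qed.

Definition descending g := forall a b, a <= b -> g b <= g a.

(** The sets D witness that the descending sequences satisfying Phi are
comeager below p, in a space where kappa many dense sets count as few. *)
Definition gforces p Phi := exists2 D : K -> set P,
  forall a, dense_below p (D a) &
  forall g, descending g -> (exists a, g a <= p) ->
    (forall a, exists b, D a (g b)) -> Phi g.

Lemma gforces_consistent p Phi : gforces p Phi ->
  exists g, [/\ descending g, exists a, g a <= p & Phi g].
Proof.
move=> [D Dd DPhi].
have [T [Tp TD Tdec _]] := fusion_tree (split := fun=> id) Dd (fun _ _ _ => lexx _).
have [a0 _] := inhabitedK hK.
have gdec : descending (T (fun=> true)).
  by move=> a b; rewrite le_eqVlt => /predU1P[->|/Tdec].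
have gp : exists a, T (fun=> true) a <= p by exists a0.
by exists (T (fun=> true)); split=> //; apply: DPhi => // a; exists a.
Qed.

Lemma gforces_le p q Phi : q <= p -> gforces p Phi -> gforces q Phi.
Proof.
move=> qp [D Dd DPhi]; exists D => [a r rq|g gdec [a gq]].
  exact/Dd/(le_trans rq).
by apply: DPhi => //; exists a; exact: le_trans gq qp.
Qed.

Lemma gforces_sub p Phi Psi : gforces p Phi ->
  (forall g, descending g -> (exists a, g a <= p) -> Phi g -> Psi g) ->
  gforces p Psi.
Proof.
by move=> [D Dd DPhi] sub; exists D => // g gdec gp gD; apply: sub => //; exact: DPhi.
Qed.

Lemma gforces_true p Phi :
  (forall g, descending g -> (exists a, g a <= p) -> Phi g) -> gforces p Phi.
Proof.
move=> H; exists (fun=> setT) => [a q qp|g gdec gp _]; last exact: H.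
by exists q.
Qed.

(** A union of kappa families of kappa dense sets is again such a family. *)
Lemma gforces_forall (h2K : two_lt_kappa_eq_kappa K) p (I : Type) (A : set I)
    (Phi : I -> set (K -> P)) : A #<= [set: K] ->
  (forall i, A i -> gforces p (Phi i)) ->
  gforces p [set g | forall i, A i -> Phi i g].
Proof.
have [k0 _] := inhabitedK hK.
move=> /(card_le_injP k0)[e eI] APhi.
have /choice[D DP] : forall i, exists D, A i ->
    (forall a, dense_below p (D a)) /\
    forall g, descending g -> (exists a, g a <= p) ->
      (forall a, exists b, D a (g b)) -> Phi i g.
  move=> i; have [Ai|nAi] := pselect (A i); last by exists (fun=> setT).
  by have [D Dd DPhi] := APhi i Ai; exists D.
have [pair pairI] := injective_pairing hK h2K.
(* Indices outside the range of the pairing impose no constraint, so no inverse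
   of the pairing has to be chosen. *)
exists (fun c => [set q | forall i a, A i -> pair (e i, a) = c -> D i a q]).
  move=> c; have [[i [a [Ai iac]]]|nc] :=
      pselect (exists i a, A i /\ pair (e i, a) = c); last first.
    by move=> q qp; exists q => // i a Ai iac; exfalso; apply: nc; exists i, a.
  move=> q /((DP i Ai).1 a)[r rq Dr]; exists r => // j b Aj.
  by rewrite -iac => /pairI[/eI-> // ->].
move=> g gdec gp gD i Ai; apply: (DP i Ai).2 => // a.
by have [b bP] := gD (pair (e i, a)); exists b; exact: bP.
Qed.

Lemma gforces_and (h2K : two_lt_kappa_eq_kappa K) p Phi Psi :
  gforces p Phi -> gforces p Psi -> gforces p (Phi `&` Psi).
Proof.
move=> hPhi hPsi; have [k0 _] := inhabitedK hK.
have [k1 k01] := exists_gt hK k0.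
apply: (gforces_sub (@gforces_forall h2K p K setT
    (fun a => if a == k0 then Phi else Psi) (card_lexx _) _)) => [a _|g _ _ H].
  by case: ifP.
split; first by have := H k0 I; rewrite eqxx.
by have := H k1 I; rewrite gt_eqF.
Qed.

Lemma predense_antichain p (E : set P) : dense_below p E ->
  exists A : set P, [/\ A `<=` E,
    forall a b r, A a -> A b -> r <= a -> r <= b -> a = b &
    forall q, q <= p -> exists a r, [/\ A a, r <= a & r <= q]].
Proof.
move=> Ed.
pose anti (A : set P) := A `<=` E /\
  forall a b r, A a -> A b -> r <= a -> r <= b -> a = b.
have [F Fanti Ftot|A [[AE Aanti] Amax]] := @Zorn_bigcup P anti.
  split=> [a [A /Fanti[AE _] /AE]//|a b r [A FA Aa] [B FB Bb]].
  have [AB|BA] := Ftot _ _ FA FB.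
    by apply: (Fanti B FB).2 => //; exact: AB.
  by apply: (Fanti A FA).2 => //; exact: BA.
exists A; split=> // q qp; apply: contrapT => nA.
have [e eq Ee] := Ed q qp.
have incomp a r : A a -> r <= a -> r <= e -> False.
  by move=> Aa ra re; apply: nA; exists a, r; split=> //; exact: le_trans eq.
apply: (Amax (A `|` [set e])); last first.
  split=> [a [/AE//|->]//|a b r [Aa|->] [Ab|->] ra rb //].
  - exact: Aanti ra rb.
  - by have := incomp _ _ Aa ra rb.
  - by have := incomp _ _ Ab rb ra.
split=> [|sub]; last by apply: (incomp e e) => //; apply: sub; right.
by move=> a; left.
Qed.

(** Different conditions r come with different witnessing dense sets, possibly
more than kappa many in total.  Taking r from an antichain makes them
compatible: a descending sequence lies below at most one member q of the
antichain, so all the sets D a that it meets refer to the same q. *)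
Lemma gforces_glue p Phi :
  dense_below p [set r | gforces r Phi] -> gforces p Phi.
Proof.
move=> /predense_antichain[A [APhi Aanti Apre]].
have /choice[D DP] : forall q, exists D, A q ->
    (forall a, dense_below q (D a)) /\
    forall g, descending g -> (exists a, g a <= q) ->
      (forall a, exists b, D a (g b)) -> Phi g.
  move=> q; have [Aq|nAq] := pselect (A q); last by exists (fun=> setT).
  by have [D Dd DPhi] := APhi q Aq; exists D.
exists (fun a => [set r | exists2 q, A q & r <= q /\ D q a r]) => [a q qp|].
  have [q' [r [Aq' rq' rq]]] := Apre q qp.
  have [s sr Ds] := (DP q' Aq').1 a r rq'.
  exists s; first exact: le_trans rq.
  by exists q' => //; split=> //; exact: le_trans rq'.
move=> g gdec _ gD; have [k0 _] := inhabitedK hK.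
have [b0 [q Aq [gq _]]] := gD k0.
apply: (DP q Aq).2 => //; first by exists b0.
move=> a; have [b [q' Aq' [gq' Db]]] := gD a; exists b.
suff -> : q = q' by [].
apply: (Aanti _ _ (g (Order.max b0 b))) => //.
  by apply: le_trans gq; apply: gdec; rewrite le_max lexx.
by apply: le_trans gq'; apply: gdec; rewrite le_max lexx orbT.
Qed.

(** The analogue of the Baire property below p. *)
Definition decides p Phi :=
  dense_below p [set r | gforces r Phi \/ gforces r (~` Phi)].

Lemma decidesC p Phi : decides p Phi -> decides p (~` Phi).
Proof.
move=> dPhi q /dPhi[r rq [h|h]]; exists r => //; [right|by left].
by rewrite /= setCK.
Qed.

Lemma decides_sub p Phi Psi : (forall g, Phi g <-> Psi g) ->
  decides p Phi -> decides p Psi.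
Proof. by move=> /predeqP ->. Qed.

(** For properties with the Baire property, generic forcing obeys the negation
clause in the definition of the forcing relation. *)
Lemma gforcesC (h2K : two_lt_kappa_eq_kappa K) p Phi : decides p Phi ->
  gforces p (~` Phi) <-> forall q, q <= p -> ~ gforces q Phi.
Proof.
move=> dPhi; split=> [hn q qp h|h].
  by have [g [_ _ []]] := gforces_consistent (gforces_and h2K h (gforces_le qp hn)).
apply: gforces_glue => q qp; have [r rq [hr|hr]] := dPhi q qp.
  by case: (h r (le_trans rq qp)).
by exists r.
Qed.

(** If no extension refutes any Phi i, then each Phi i is forced densely, hence
outright by gluing. *)
Lemma decides_forall (h2K : two_lt_kappa_eq_kappa K) p (I : Type) (A : set I)
    (Phi : I -> set (K -> P)) : A #<= [set: K] ->
  (forall i, A i -> decides p (Phi i)) ->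
  decides p [set g | forall i, A i -> Phi i g].
Proof.
move=> cA dPhi q qp.
have [[i [r [Ai rq hr]]]|nr] := pselect (exists i r,
    [/\ A i, r <= q & gforces r (~` Phi i)]).
  exists r => //; right; apply: (gforces_sub hr) => g _ _ ni.
  by apply: contra_not ni; exact.
exists q => //; left; apply: gforces_forall => // i Ai; apply: gforces_glue.
move=> r rq; have [s sr [//|ns]] := dPhi i Ai r (le_trans rq qp); first by exists s.
by exfalso; apply: nr; exists i, s; split=> //; exact: le_trans rq.
Qed.

End GenericSequences.

(** * Names and codes along generic sequences *)

Section Names.
Context d (K : orderType d) (hK : regular_uncountable K).
Context d' (P : preorderType d') (hP : kclosed K P).
Context (h2K : two_lt_kappa_eq_kappa K) (X : choiceType) (x0 : X).
Implicit Types (p q r : P) (g : K -> P) (tau : pname K X P).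

Lemma forces_pair_le p q tau a x :
  q <= p -> forces_pair p tau a x -> forces_pair q tau a x.
Proof. by move=> qp h r rq; apply: h; exact: le_trans qp. Qed.

Lemma forces_pair_glue p tau a x :
  dense_below p [set r | forces_pair r tau a x] -> forces_pair p tau a x.
Proof.
move=> h q /h[r rq /(_ r (lexx r))[s sr taus]].
by exists s => //; exact: le_trans sr rq.
Qed.

Lemma forces_fun_le p q tau : q <= p -> forces_fun p tau -> forces_fun q tau.
Proof.
move=> qp [tot fn]; split=> [a r rq|a x y xy r rq].
  exact/tot/(le_trans rq).
exact/(fn a x y xy)/(le_trans rq).
Qed.

(** Along a descending sequence that decides the coordinate a, this is the
decided value; x0 is a junk value for the other sequences. *)
Definition name_val tau g : bspace K X :=
  fun a => xget x0 [set x | exists b, forces_pair (g b) tau a x].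

Lemma name_valE p tau g a b x : forces_fun p tau -> descending g ->
  (exists c, g c <= p) -> forces_pair (g b) tau a x -> name_val tau g a = x.
Proof.
move=> [_ fn] gdec [c gcp] gx; rewrite /name_val.
case: xgetP => [y _ [b' gy]|/(_ x)[]]; last by exists b.
apply: contrapT => yx; pose e := Order.max c (Order.max b b').
apply: (fn a y x yx (g e)).
  by apply: le_trans gcp; apply: gdec; rewrite le_max lexx.
split.
  by apply: forces_pair_le gy; apply: gdec; rewrite !le_max lexx !orbT.
by apply: forces_pair_le gx; apply: gdec; rewrite !le_max lexx !orbT.
Qed.

Lemma gforces_evaluates p tau : forces_fun p tau ->
  gforces p [set g | forall a, exists b, forces_pair (g b) tau a (name_val tau g a)].
Proof.
move=> ftau; exists (fun a => [set r | exists x, forces_pair r tau a x]).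
  by case: ftau.
move=> g gdec gp gD a; have [b [x gx]] := gD a.
by exists b; rewrite (name_valE ftau gdec gp gx).
Qed.

Lemma forces_pairP p tau a x : forces_fun p tau ->
  forces_pair p tau a x <-> gforces p (name_val tau @^-1` [set y | y a = x]).
Proof.
move=> ftau; split=> [px|h].
  apply: gforces_true => g gdec [b gb] /=.
  apply: (@name_valE p _ _ _ b) => //; first by exists b.
  exact: forces_pair_le px.
apply: forces_pair_glue => q qp; have [r rq [y ry]] := ftau.1 a q qp.
exists r => //; have rp := le_trans rq qp.
have [g [gdec [b gr] /= <-]] := gforces_consistent hK hP (gforces_le rp h).
rewrite (@name_valE p _ _ _ b y) //; first by exists b; exact: le_trans rp.
exact: forces_pair_le ry.
Qed.

Lemma forces_coneP p tau s : forces_fun p tau ->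
  forces_cone p tau s <-> gforces p (name_val tau @^-1` bcone s).
Proof.
move=> ftau; split=> [ps|h b].
  apply: gforces_true => g gdec [b gb] c.
  apply: (@name_valE p _ _ _ b) => //; first by exists b.
  exact: forces_pair_le (ps c).
apply/forces_pairP => //. by apply: (gforces_sub h) => g _ _ H; exact: H.
Qed.

(** If no extension of q puts tau into a cone inside U, then q generically
forces that tau avoids U: a value in U would have a stem of length below kappa
inside U, and by regularity some member of the sequence decides this whole
stem. *)
Lemma decides_open p tau U : forces_fun p tau -> open U ->
  decides p (name_val tau @^-1` U).
Proof.
move=> ftau /(open_bspace hK) oU q qp; have fq := forces_fun_le qp ftau.
have [[s [r [rq sU rs]]]|ns] := pselect (exists s r,
    [/\ r <= q, bcone s `<=` U & forces_cone r tau s]).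
  exists r => //; left; have fr := forces_fun_le rq fq.
  by apply: (gforces_sub ((forces_coneP s fr).1 rs)) => g _ _; exact: sU.
exists q => //; right. apply: (gforces_sub (gforces_evaluates fq)).
move=> g gdec [b gb] /choice[e eP] /oU[a aU]; apply: ns.
have [c ec] := ru_regular hK a e.
exists (initial_seq a (name_val tau g)), (g (Order.max b c)); split.
- by apply: le_trans gb; apply: gdec; rewrite le_max lexx.
- by move=> y /bcone_initial /aU.
move=> [i ia] /=; apply: forces_pair_le (eP i); apply: gdec.
by rewrite le_max (ltW (ec i ia)) orbT.
Qed.

Lemma decides_kborel p tau A : forces_fun p tau -> kborel K A ->
  decides p (name_val tau @^-1` A).
Proof.
move=> ftau; elim=> {A} [U|A _ IH|F cF _ IH].
- exact: decides_open.
- exact: decidesC.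
apply: (@decides_sub _ _ _ _ _
    (~` [set g | forall A, F A -> (~` (name_val tau @^-1` A)) g])).
  move=> g; split=> [nF|[A FA Ag] /(_ A FA)//].
  by apply: contrapT => nA; apply: nF => A FA Ag; apply: nA; exists A.
apply: decidesC; apply: decides_forall => // A FA.
exact/decidesC/IH.
Qed.

End Names.

Section Codes.
Context d (K : orderType d) (hK : regular_uncountable K).
Context d' (P : preorderType d') (hP : kclosed K P).
Context (h2K : two_lt_kappa_eq_kappa K) (k0 : K) (c : bcode K).
Implicit Types (p q r : P) (tau : pname K K P).
Local Notation val tau := (name_val k0 tau).

Lemma bc_interp_leaf s (h : Acc (@bc_succ d K c) s) :
  bc_leaf s -> bc_interp h = bcone (bc_val s).
Proof. by case: h => h; rewrite /=; case: pselect. Qed.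

Lemma bc_interp_node s (h : Acc (@bc_succ d K c) s) : ~ bc_leaf s ->
  bc_interp h = [set x | forall t (ts : bc_succ t s), ~ bc_interp (Acc_inv h ts) x].
Proof. by case: h => h; rewrite /=; case: pselect. Qed.

Lemma forces_interp_leaf p tau s (h : Acc (@bc_succ d K c) s) : bc_leaf s ->
  forces_interp p tau h = forces_cone p tau (bc_val s).
Proof. by case: h => h; rewrite /=; case: pselect. Qed.

Lemma forces_interp_node p tau s (h : Acc (@bc_succ d K c) s) : ~ bc_leaf s ->
  forces_interp p tau h = forall t (ts : bc_succ t s) q, q <= p ->
    ~ forces_interp q tau (Acc_inv h ts).
Proof. by case: h => h; rewrite /=; case: pselect. Qed.

Lemma card_bc_succ s : [set t | @bc_succ d K c t s] #<= [set: K].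
Proof.
apply: card_le_trans (bc_card c).
suff -> : [set t | bc_succ t s] = rcons s @` [set a | bc_succ (rcons s a) s].
  exact: card_le_trans (card_image_le _ _) (card_leT _).
rewrite eqEsubset; split=> [t ts|t [a ts <-//]].
by have [_ [a ta]] := ts; exists a => /=; rewrite -ta.
Qed.

(** The clause for inner nodes as an intersection over the at most kappa
successors of s, the form to which the closure properties apply. *)
Lemma bc_interp_nodeE s (h : Acc (@bc_succ d K c) s) : ~ bc_leaf s ->
  bc_interp h = [set x | forall t, [set t | bc_succ t s] t ->
    exists ts : bc_succ t s, ~ bc_interp (Acc_inv h ts) x].
Proof.
move=> nl; rewrite bc_interp_node // predeqE => x; split=> H t ts.
  by exists ts; exact: H.
by have [ts'] := H t ts; rewrite (Prop_irrelevance ts' ts).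
Qed.

Lemma decides_exists_proof p (Q : Prop) (Phi : Q -> set (K -> P)) (w : Q) :
  decides p (Phi w) -> decides p [set g | exists w, Phi w g].
Proof.
apply: decides_sub => g; split=> [|[w']]; first by exists w.
by rewrite (Prop_irrelevance w' w).
Qed.

(** Sets coded by subtrees have the Baire property, which the negation step of
the truth lemma needs. *)
Lemma decides_interp p tau s (h : Acc (@bc_succ d K c) s) : forces_fun p tau ->
  decides p (val tau @^-1` bc_interp h).
Proof.
move=> ftau; have ha := h; move: h; elim: s / ha => s _ IH h.
have [l|nl] := pselect (bc_leaf s).
  rewrite bc_interp_leaf //; apply: decides_open => //.
  apply/(open_bspace hK) => x xs; exists (ltk_len (bc_val s)) => y xy b.
  by rewrite -xs (xy _ (svalP b)).
rewrite bc_interp_nodeE //; apply: (decides_forall hK h2K (card_bc_succ s)) => t ts.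
by apply: (decides_exists_proof (w := ts)); apply: decidesC; exact: IH.
Qed.

(** Truth lemma: the forcing relation computed along a code agrees with generic
forcing of the coded set. *)
Lemma forces_interpP p tau s (h : Acc (@bc_succ d K c) s) : forces_fun p tau ->
  forces_interp p tau h <-> gforces p (val tau @^-1` bc_interp h).
Proof.
have ha := h; move: h p; elim: s / ha => s _ IH h p ftau.
have [l|nl] := pselect (bc_leaf s).
  by rewrite bc_interp_leaf // forces_interp_leaf //; exact: forces_coneP.
rewrite forces_interp_node //.
have step t (ts : bc_succ t s) :
    (forall q, q <= p -> ~ forces_interp q tau (Acc_inv h ts)) <->
    gforces p (~` (val tau @^-1` bc_interp (Acc_inv h ts))).
  rewrite gforcesC //; last exact: decides_interp.
  split=> H q qp; have fq := forces_fun_le qp ftau.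
    by move=> /(IH t ts _ _ fq); exact: H.
  by move=> /(IH t ts _ _ fq); exact: H.
split=> [H|H t ts].
  rewrite bc_interp_nodeE //; apply: (gforces_forall hK h2K (card_bc_succ s)) => t ts.
  by apply: (gforces_sub ((step t ts).1 (H t ts))) => g _ _ ng; exists ts.
apply/step; rewrite bc_interp_node // in H.
by apply: (gforces_sub H) => g _ _; exact.
Qed.

Lemma forces_inP p tau : forces_fun p tau ->
  forces_in p tau c <-> gforces p (val tau @^-1` bc_set c).
Proof. exact: forces_interpP. Qed.

End Codes.

(** * Cohen forcing *)

Section Cohen.
Context d (K : orderType d).

(** Partial functions with bounded domain, rather than binary sequences of
length below kappa: the lower bound of a chain is then its pointwise union. *)
Record cohen := Cohen {
  cohen_fun :> K -> option bool ;
  cohen_bounded : exists a, forall b, a <= b -> cohen_fun b = None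
}.

Definition cohen_le (q p : cohen) : bool :=
  `[< forall a v, p a = Some v -> q a = Some v >].

Fact cohen_le_refl : reflexive cohen_le.
Proof. by move=> p; apply/asboolP. Qed.

Fact cohen_le_trans : transitive cohen_le.
Proof.
move=> q p r /asboolP pq /asboolP qr; apply/asboolP => a v rv.
exact/pq/qr.
Qed.

HB.instance Definition _ := gen_eqMixin cohen.
HB.instance Definition _ := gen_choiceMixin cohen.
HB.instance Definition _ := @Order.Le_isPreorder.Build
  (Order.Disp tt tt) cohen cohen_le cohen_le_refl cohen_le_trans.

Lemma cohen_leP (q p : cohen) :
  q <= p <-> forall a v, p a = Some v -> q a = Some v.
Proof. by split=> [/asboolP|H]; last exact/asboolP. Qed.

Context (hK : regular_uncountable K).

Lemma cohen_kclosed : kclosed K cohen.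
Proof.
move=> a s sdec.
have compat b c x v w : s b x = Some v -> s c x = Some w -> v = w.
  move=> sv sw; apply: Some_inj; case: (ltgtP (sval b) (sval c)) => bc.
  - by rewrite -sw; apply/esym; exact: (cohen_leP _ _).1 (sdec b c bc) _ _ sv.
  - by rewrite -sv; exact: (cohen_leP _ _).1 (sdec c b bc) _ _ sw.
  - by rewrite -sv -sw; congr (cohen_fun (s _) _); exact: val_inj.
pose u x := xget None [set o | exists b v, o = Some v /\ s b x = Some v].
have uE b x v : s b x = Some v -> u x = Some v.
  move=> sv; rewrite /u; case: xgetP => [_ _ [c [w [-> sw]]]|/(_ (Some v))[]].
    by rewrite (compat _ _ _ _ _ sw sv).
  by exists b, v.
have /choice[m mP] : forall b : K, exists e, forall h : b < a,
    forall x, e <= x -> s (exist _ b h) x = None.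
  move=> b; have [h|nh] := pselect (b < a); last by exists b.
  have [e eP] := cohen_bounded (s (exist _ b h)); exists e => h' x.
  by rewrite (Prop_irrelevance h' h); exact: eP.
have [e eP] := ru_regular hK a m.
have ub : exists e, forall x, e <= x -> u x = None.
  exists e => x ex; rewrite /u; case: xgetP => // o _ [[b ba] [v [_]]].
  by rewrite mP //; apply: ltW; exact: lt_le_trans (eP b ba) ex.
by exists (Cohen ub) => b; apply/cohen_leP => x v /uE.
Qed.

Lemma cohen_extend (p : cohen) a v : p a = None ->
  exists q : cohen, q <= p /\ q a = Some v.
Proof.
move=> pa; have [e eP] := cohen_bounded p; have [b ab] := exists_gt hK a.
have qb : exists e, forall x, e <= x -> (if x == a then Some v else p x) = None.
  exists (Order.max e b) => x; rewrite ge_max => /andP[ex bx].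
  by rewrite gt_eqF ?eP //; exact: lt_le_trans bx.
exists (Cohen qb); split; last by rewrite /= eqxx.
by apply/cohen_leP => x w pw /=; case: eqP => // xa; rewrite xa pa in pw.
Qed.

Lemma cohen_adds_new_binary : adds_new_binary K cohen.
Proof.
pose tau : pname K bool cohen := [set z : cohen * (K * bool) | z.1 z.2.1 = Some z.2.2].
have tauE (q : cohen) a v : q a = Some v -> forces_pair q tau a v.
  move=> qa r rq; exists r => //; exists q => //.
have tauN (q : cohen) a v w : forces_pair q tau a v -> q a = Some w -> v = w.
  move=> /(_ q (lexx q))[r rq [s sv rs]] qa; apply: Some_inj.
  by rewrite -((cohen_leP _ _).1 rs _ _ sv) ((cohen_leP _ _).1 rq _ _ qa).
move=> p q qp; exists q => //; exists tau; split; last first.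
  move=> x _ r _ rx; have [e eP] := cohen_bounded r.
  have [s [sr se]] := cohen_extend (~~ x e) (eP e (lexx e)).
  have := tauN s e (x e) (~~ x e) (forces_pair_le sr (rx e)) se.
  by case: (x e).
split=> [a r _|a v w vw r _ [rv rw]].
  case E : (r a) => [v|]; first by exists r => //; exists v; exact: tauE.
  have [s [sr sa]] := cohen_extend true E; exists s => //.
  by exists true; exact: tauE.
case E : (r a) => [u|].
  by apply: vw; rewrite (tauN _ _ _ _ rv E) (tauN _ _ _ _ rw E).
have [s [sr sa]] := cohen_extend true E; apply: vw.
rewrite (tauN _ _ _ _ (forces_pair_le sr rv) sa).
by rewrite (tauN _ _ _ _ (forces_pair_le sr rw) sa).
Qed.

End Cohen.

(** * A perfect set from a new element *)

Section PerfectSet.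
Context d (K : orderType d) (hK : regular_uncountable K).
Context (h2K : two_lt_kappa_eq_kappa K) (c : bcode K).
Context d' (P : preorderType d') (hP : kclosed K P).

(** Otherwise q decides every coordinate of tau.  The decided point x is the
value of tau along every generic sequence below q, so x lies in the coded set,
although tau is forced to differ from all its ground model elements. *)
Lemma split_new_element (k0 : K) p (tau : pname K K P) q :
  forces_fun p tau -> forces_in p tau c -> forces_notin p tau (bc_set c) ->
  q <= p -> exists a (v : bool -> K) (r : bool -> P), v true <> v false /\
    forall e, r e <= q /\ forces_pair (r e) tau a (v e).
Proof.
move=> ftau /(forces_inP hK hP h2K k0 _ ftau) hin hnot qp.
have fq := forces_fun_le qp ftau; apply: contrapT => nsplit.
have /choice[x xP] : forall a, exists v, forces_pair q tau a v.
  move=> a; have [r rq [v rv]] := fq.1 a q (lexx q).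
  exists v; apply: forces_pair_glue => s sq.
  have [t ts [w tw]] := fq.1 a s sq; exists t => //.
  suff -> : v = w by [].
  apply: contrapT => vw; apply: nsplit.
  exists a, (fun e : bool => if e then v else w), (fun e : bool => if e then r else t).
  by split=> // -[] //; split=> //; exact: le_trans sq.
apply: (hnot x _ q qp xP).
have [g [gdec gq xg]] := gforces_consistent hK hP (gforces_le qp hin).
suff -> : x = name_val k0 tau g by [].
apply/funext => a; have [b gb] := gq.
rewrite (@name_valE _ _ _ _ _ _ q _ _ _ b (x a)) //.
exact: forces_pair_le (xP a).
Qed.

(** Condition T x a splits the coordinate pt of tau into the values vl true
and vl false, and direction x a takes the side vl (x a).  So x a is recovered
by comparing f x at pt with vl true.  The same comparisons make sense for an
arbitrary y in place of f x; carried out by recursion on a, they define g y. *)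
Lemma perfect_subset : adds_new_to P c ->
  exists A : set (bspace K K), kperfect A /\ A `<=` bc_set c.
Proof.
move=> hnew; have [k0 _] := inhabitedK hK.
have [k1 _ k1min] := least_elt hK (ex_intro setT k0 I).
have empty (b : {b : K | b < k1}) : False.
  by case: b => b; rewrite ltNge k1min.
have [p0 _] := hP (s := fun b => False_rect P (empty b))
  (fun b => False_rect _ (empty b)).
have [p _ [tau [ftau hin hnot]]] := hnew p0 p0 (lexx p0).
have [D Dd DB] := gforces_and hK h2K (gforces_evaluates k0 ftau)
  ((forces_inP hK hP h2K k0 _ ftau).1 hin).
have /choice[S SP] : forall q, exists z : K * (bool -> K) * (bool -> P),
    q <= p -> z.1.2 true <> z.1.2 false /\
    forall e, z.2 e <= q /\ forces_pair (z.2 e) tau z.1.1 (z.1.2 e).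
  move=> q; have [qp|nqp] := pselect (q <= p); last first.
    by exists (k0, fun=> k0, fun=> q).
  have [a [v [r avr]]] := split_new_element k0 ftau hin hnot qp.
  by exists (a, v, r).
pose pt q := (S q).1.1; pose vl q := (S q).1.2; pose sp e q := (S q).2 e.
have [|T [Tp TD Tsp Teq]] := fusion_tree hK hP (split := sp) Dd.
  by move=> e q /SP[_ /(_ e)[]].
have Tdec x : descending (T x).
  move=> a b; rewrite le_eqVlt => /predU1P[->//|ab].
  apply: le_trans (Tsp x a b ab) _; exact: ((SP _ (Tp x a)).2 _).1.
have Tcone x : exists a, T x a <= p by exists k0.
pose f (x : bspace K bool) : bspace K K := name_val k0 tau (T x).
have fP x : (forall a, exists b, forces_pair (T x b) tau a (f x a)) /\ bc_set c (f x).
  by apply: DB => // a; exists a.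
(* T is defined on total branches only; the padding with false above a is
   harmless as T x a depends on x below a. *)
pose tot a (z : forall b, b < a -> bool) : K -> bool := fun b =>
  if pselect (b < a) is left h then z b h else false.
pose G (y : K -> K) a (z : forall b, b < a -> bool) : bool :=
  let q := T (tot a z) a in `[< y (pt q) = vl q true >].
pose g (y : bspace K K) : bspace K bool := Fix (ru_wf hK) (fun=> bool) (G y).
have gE y a : g y a = `[< y (pt (T (g y) a)) = vl (T (g y) a) true >].
  rewrite {1}/g Fix_eq.
    rewrite /G /= (Teq _ (g y)) // => b ba; rewrite /tot.
    by case: pselect.
  move=> b h h' hh'; congr G.
  apply: functional_extensionality_dep => e.
  by apply: functional_extensionality_dep => ?; exact: hh'.
have fcont : continuous f.
  apply: continuous_bspace => // x a; have [b xb] := (fP x).1 a.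
  exists b => y xy; apply/esym; apply: (@name_valE _ _ _ _ _ _ p _ _ _ b) => //.
  by rewrite -(Teq x).
have gcont : continuous g.
  apply: continuous_bspace => // y a.
  have [b bP] := bounded_image hK a (fun e => pt (T (g y) e)).
  exists b => y' yy'.
  suff H e : e <= a -> g y e = g y' e by exact: H.
  elim/(ltk_ind hK): e => e IH ea.
  rewrite !gE -(Teq (g y)) ?yy' //; first exact: bP.
  by move=> e' ee'; apply: IH => //; exact: le_trans (ltW ee') ea.
have fK : cancel f g.
  move=> x; apply/funext => a; elim/(ltk_ind hK): a => a IH.
  rewrite gE (Teq _ x) //; have [vtf spP] := SP _ (Tp x a).
  have -> : f x (pt (T x a)) = vl (T x a) (x a).
    have [b ab] := exists_gt hK a.
    apply: (@name_valE _ _ _ _ _ _ p _ _ _ b) => //.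
    exact: forces_pair_le (Tsp x a b ab) (spP (x a)).2.
  by case: (x a); [exact/asboolP|apply/asboolP => /esym].
(* f o g is a continuous retraction onto the range of f. *)
have rangeE : range f = [set y | f (g y) = y].
  rewrite eqEsubset; split=> [_ [x _ <-]|y fgy] /=; first by rewrite fK.
  by exists (g y).
exists (range f); split; last by move=> _ [x _ <-]; exact: (fP x).2.
split.
  rewrite rangeE; apply: (closed_fixpoints hK (h := f \o g)).
  by move=> y; apply: continuous_comp; [exact: gcont|exact: fcont].
exists f, g; split=> //; exact: continuous_subspaceT.
Qed.

End PerfectSet.

(** * A new element from a Borel injection *)

Section BorelInjection.
Context d (K : orderType d) (hK : regular_uncountable K).
Context (h2K : two_lt_kappa_eq_kappa K) (c : bcode K).
Context d' (P : preorderType d') (hP : kclosed K P).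

(** The name sigma collects the generically forced coordinates of f(tau);
injectivity of f transfers the newness of tau to sigma. *)
Lemma borel_injection_adds_new (f : bspace K bool -> bspace K K) :
  kborel_fun K f -> injective f -> range f `<=` bc_set c ->
  adds_new_binary K P -> adds_new_to P c.
Proof.
move=> fB fI fc hnew p0 p pp0; have [q qp [tau [ftau hnot]]] := hnew p0 p pp0.
have [k0 _] := inhabitedK hK.
exists q => //; pose ev := name_val false tau.
pose coord a b : set (K -> P) := ev @^-1` (f @^-1` [set y | y a = b]).
have coord_dec r a b : r <= q -> decides r (coord a b).
  move=> rq; apply: decides_kborel => //; first exact: forces_fun_le ftau.
  by apply: fB; exact: (open_coord hK).
pose sigma : pname K K P :=
  [set z | z.1 <= q /\ gforces z.1 (coord z.2.1 z.2.2)].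
have sigmaP r a b : r <= q ->
    forces_pair r sigma a b <-> gforces r (coord a b).
  move=> rq; split=> [H|H s sr].
    apply: (gforces_glue hK) => s /H[t ts [u [uq hu] tu]].
    by exists t => //; exact: gforces_le hu.
  exists s => //; exists s => //; split; first exact: le_trans rq.
  exact: gforces_le H.
have fsigma : forces_fun q sigma.
  split=> [a r rq|a b b' bb' r rq [/sigmaP hb /sigmaP hb']].
    have [[s [b [sr sb]]]|ns] := pselect (exists s b, s <= r /\ gforces s (coord a b)).
      exists s => //; exists b; apply/sigmaP => //; exact: le_trans rq.
    have nb b : setT b -> gforces r (~` coord a b).
      move=> _; apply/(gforcesC hK hP h2K); first exact: coord_dec.
      by move=> s sr sb; apply: ns; exists s, b.
    have [g [_ _ /(_ (f (ev g) a) I)[]]] := gforces_consistent hK hP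
      (gforces_forall hK h2K (card_lexx _) nb).
    by [].
  have [g [_ _ [/= e e']]] := gforces_consistent hK hP
    (gforces_and hK h2K (hb rq) (hb' rq)).
  by apply: bb'; rewrite -e -e'.
(* Densely many conditions decide sigma at a, and each decides the right value
   because sigma is defined through generic forcing of f(tau) at a. *)
have sigma_val : gforces q [set g | name_val k0 sigma g = f (ev g)].
  have coordE a : setT a ->
      gforces q [set g | name_val k0 sigma g a = f (ev g) a].
    move=> _; apply: (gforces_glue hK) => r rq; have [s sr [b sb]] := fsigma.1 a r rq.
    have sq := le_trans sr rq.
    exists s => //.
    apply: (gforces_sub ((sigmaP s a b sq).1 sb)) => g gdec [e ge] /= ->.
    apply: (@name_valE _ _ _ _ _ _ s _ _ _ e) => //.
    - exact: forces_fun_le fsigma.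
    - by exists e.
    - exact: forces_pair_le sb.
  apply: (gforces_sub (gforces_forall hK h2K (card_lexx _) coordE)) => g _ _ H.
  by apply/funext => a; exact: H.
exists sigma; split=> //.
  apply/(forces_inP hK hP h2K k0 _ fsigma).
  by apply: (gforces_sub sigma_val) => g _ _ /= ->; apply: fc; exists (ev g).
move=> y _ r rq ry.
have ry' : gforces r [set g | forall a, setT a -> coord a (y a) g].
  apply: (gforces_forall hK h2K (card_lexx _)) => a _.
  by apply/sigmaP.
have [g [_ _ gcoord]] := gforces_consistent hK hP ry'.
have gy : f (ev g) = y by apply/funext => a; exact: gcoord.
(* A condition s below r forcing tau to differ from ev g at a would have a
   generic value other than ev g that f also sends to y. *)
apply: (hnot (ev g) I r rq) => a.
have fr := forces_fun_le rq ftau.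
apply/(forces_pairP hK hP false _ _ fr).
have /(decides_kborel hK hP h2K false fr) dec :
  kborel K [set x : bspace K bool | x a = ev g a].
  by apply: kborel_open; exact: (open_coord hK).
rewrite -[X in gforces _ X]setCK; apply/(gforcesC hK hP h2K); first exact: decidesC.
move=> s sr hs.
have [h [_ _ [hx hy]]] := gforces_consistent hK hP
  (gforces_and hK h2K hs (gforces_le sr ry')).
apply: hx => /=; congr (_ a); apply: fI; rewrite gy.
by apply/funext => b; exact: hy.
Qed.

End BorelInjection.

(** * The equivalence *)

Theorem corollary6p10 (d : Order.disp_t) (K : orderType d)
    (hK : regular_uncountable K) (h2K : two_lt_kappa_eq_kappa K)
    (c : bcode K) :
  [<-> (* (1) *)
       forall (d' : Order.disp_t) (P : preorderType d'),
         kclosed K P -> adds_new_binary K P -> adds_new_to P c;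
       (* (2) *)
       exists (d' : Order.disp_t) (P : preorderType d'),
         kclosed K P /\ adds_new_to P c;
       (* (3) *)
       exists A : set (bspace K K), kperfect A /\ A `<=` bc_set c;
       (* (4) *)
       exists f : bspace K bool -> bspace K K,
         [/\ kborel_fun K f, injective f & range f `<=` bc_set c]].
Proof.
split.
  move=> H; exists (Order.Disp tt tt), (cohen K : preorderType _).
  have hC := cohen_kclosed hK; split=> //.
  exact/H/cohen_adds_new_binary.
split; first by move=> [d' [P [hP hnew]]]; exact: perfect_subset hP hnew.
split.
  move=> [_ [[_ [f [g [fc _ <- fK]]]] fB]].
  exists f; split=> //; last exact: can_inj fK.
  by move=> O oO; apply: kborel_open; exact: (@continuousP _ _ f).1 fc O oO.
move=> [f [fB fI fc]] d' P hP.
exact: borel_injection_adds_new fB fI fc.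
Qed.
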